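(* Let $\mathbb{X}\subset\mathbb{R}^n$ be compact with $\mathbf{0}$ an interior point of $\mathbb{X}$. Suppose $\mathbf{f}\in\mathcal{C}(\mathbb{X};\mathbb{R}^d)$, $\mathbf{f}(\mathbf{0})=\mathbf{0}$, and $\mathbf{f}$ is continuously differentiable in a neighborhood of $\mathbf{0}$. Then for all $\varepsilon>0$, there exists a feedforward neural network with bounded, non-constant, $\mathcal{C}^1$ activation functions, $\mathcal{N}\in\mathcal{C}^1(\mathbb{X};\mathbb{R}^d)$, such that for all $\mathbf{x}\in\mathbb{X}$, $$\left\|\mathbf{f}(\mathbf{x})-\left(\left[\frac{\partial\mathbf{f}}{\partial\mathbf{x}}(\mathbf{0})-\frac{\partial\mathcal{N}}{\partial\mathbf{x}}(\mathbf{0})\right]\mathbf{x}+\mathcal{N}(\mathbf{x})-\mathcal{N}(\mathbf{0})\right)\right\|_1<\varepsilon.$$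
   Context: $\mathcal{C}(\mathbb{X};\mathbb{R}^d)$ is the space of continuous functions $\mathbb{X}\to\mathbb{R}^d$, and $\mathcal{C}^1(\mathbb{X};\mathbb{R}^d)$ the space of continuously differentiable ones; $\|\cdot\|_1$ is the $\ell^1$ norm on $\mathbb{R}^d$; $\partial\mathbf{f}/\partial\mathbf{x}$ denotes the Jacobian matrix. A feedforward neural network is a function $\mathbb{R}^n\to\mathbb{R}^d$ (restricted to $\mathbb{X}$) given by a finite composition of layers, each hidden layer being an affine map followed by a scalar activation function $\mathbb{R}\to\mathbb{R}$ applied componentwise, with at least one hidden layer, and the output layer being affine. *)

(* Defs.v *)
From HB Require Import structures.
From mathcomp Require Import all_boot all_order all_algebra.
From mathcomp Require Import all_classical all_reals all_analysis.

Set Implicit Arguments.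
Unset Strict Implicit.
Unset Printing Implicit Defensive.

Import Order.TTheory GRing.Theory Num.Theory.
Import numFieldNormedType.Exports.

Local Open Scope classical_set_scope.
Local Open Scope ring_scope.

Definition l1norm (R : realType) (d : nat) (v : 'rV[R]_d) : R :=
  \sum_(i < d) `|v ord0 i|.

(* The topology of 'rV[R]_n comes from the sup norm, as does that of the
   Jacobian matrices. With [A] a point this is "continuously differentiable in a
   neighborhood of the point"; with [A] compact it is membership in C^1(A) for
   a function that is defined on the whole space. *)
Definition C1_near (R : realType) (n d : nat) (A : set 'rV[R]_n)
    (f : 'rV[R]_n -> 'rV[R]_d) : Prop :=
  exists U : set 'rV[R]_n,
    [/\ open U, A `<=` U, forall x, U x -> differentiable f x
      & {within U, continuous (jacobian f)}].

Definition C1_scalar (R : realType) (s : R -> R) : Prop :=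
  (forall t, derivable s t 1) /\ continuous (derive1 s).

(* Each hidden layer has its own width and its own activation function; the
   width is [m.+1] so that no layer is empty. *)
Inductive network (R : realType) (d : nat) : nat -> Type :=
| Output (n : nat) (W : 'M[R]_(n, d)) (b : 'rV[R]_d) : network R d n
| Hidden (n m : nat) (W : 'M[R]_(n, m.+1)) (b : 'rV[R]_m.+1) (s : R -> R)
    (N : network R d m.+1) : network R d n.

(* Vectors are rows, so an affine map is x |-> x W + b. *)
Fixpoint net_eval (R : realType) (d n : nat) (N : network R d n) :
    'rV[R]_n -> 'rV[R]_d :=
  match N in network _ _ k return 'rV[R]_k -> 'rV[R]_d with
  | Output _ W b => fun x => x *m W + b
  | Hidden _ _ W b s N' => fun x => net_eval N' (map_mx s (x *m W + b))
  end.

Fixpoint hidden_layers (R : realType) (d n : nat) (N : network R d n) : nat :=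
  match N with
  | Output _ _ _ => 0%N
  | Hidden _ _ _ _ _ N' => (hidden_layers N').+1
  end.

Fixpoint activations (R : realType) (d n : nat) (N : network R d n) :
    set (R -> R) :=
  match N with
  | Output _ _ _ => set0
  | Hidden _ _ _ _ s N' => [set s] `|` activations N'
  end.

(* Main.v *)
Require Import Defs.
From HB Require Import structures.
From mathcomp Require Import all_boot all_order all_algebra.
From mathcomp Require Import all_classical all_reals all_analysis.
From mathcomp Require Import lra ring.

Import Order.TTheory GRing.Theory Num.Theory.
Import numFieldNormedType.Exports.

Set Implicit Arguments.
Unset Strict Implicit.
Unset Printing Implicit Defensive.

Local Open Scope classical_set_scope.
Local Open Scope ring_scope.

(** The linear correction term absorbs any Jacobian, so the Jacobian of [f] at
    the origin never has to be approximated. Put [g x := f x - x *m J] with [J]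
    the Jacobian of [f] at 0; then [g 0 = 0]. If a network [h] is uniformly
    close to [g] on [X] and has Jacobian zero at 0, the quantity to bound is
    [(g x - h x) - (g 0 - h 0)], which is small.

    The activation function may be chosen, and cosine is bounded, non-constant
    and C^1. Networks with one hidden layer of cosines compute exactly the
    sums of [cos (x . w + b) *: v]. By the addition formulas the scalar ones
    form an algebra, it contains the constants and separates points, and
    [Stone_Weierstrass] makes it dense in the continuous functions on [X]
    ([cos_sum_approximates], [cos_sum_vector_approximates]).

    It remains to make the Jacobian at 0 vanish without spoiling the uniform
    approximation. A fast oscillation of small amplitude,
    [sin (K (x . w)) *: (v / K)], has Jacobian [w *m v] at 0 for every [K],
    while its size is [O(1/K)]. Adding such terms gives an arbitrarily small
    cosine sum with any prescribed Jacobian at 0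
    ([cos_sum_small_with_jacobian]); the one that cancels the Jacobian of the
    approximant yields [cos_sum_flat_approximates]. *)

(** * Polynomial approximation of the absolute value *)

(** Approximations from below of the square root of [t ^+ 2] by iterates that are
    polynomials in [t], so that they stay in any algebra of functions. *)
Fixpoint abs_iter (R : realType) (n : nat) (t : R) : R :=
  if n is k.+1 then abs_iter k t + (t ^+ 2 - abs_iter k t ^+ 2) / 2 else 0.

(** The error [r] of one step becomes [r * (1 - (|t| + p) / 2)], which is at most
    [r * (1 - r / 2)] because [0 <= p]; this recursion forces [r <= 2 / (n + 2)].
    The rate does not depend on [t], so the convergence is uniform. *)
Lemma abs_iter_bounds (R : realType) (n : nat) (t : R) : `|t| <= 1 ->
  [/\ 0 <= abs_iter n t, abs_iter n t <= `|t|
    & n.+2%:R * (`|t| - abs_iter n t) <= 2].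
Proof.
move=> t1; elim: n => [|n [p0 pt IH]] /=.
  by rewrite subr0; split=> //; lra.
rewrite -(real_normK (num_real t)).
move: (abs_iter n t) p0 pt IH => p; set u := `|t| in t1 *.
move=> p0 pu; rewrite -[n.+3%:R]natr1; set m : R := n.+2%:R; move=> IH.
have m2 : 2 <= m by rewrite /m ler_nat.
split; [nra|nra|].
have -> : u - (p + (u ^+ 2 - p ^+ 2) / 2) = (u - p) * (1 - (u + p) / 2)
  by field.
set r := u - p in IH *.
have step : (m + 1) * (r * (1 - (u + p) / 2)) <= (m + 1) * (r * (1 - r / 2)).
  by rewrite ler_pM2l; [apply: ler_wpM2l; rewrite /r; lra|lra].
apply: (le_trans step); rewrite -subr_ge0.
have -> : 2 - (m + 1) * (r * (1 - r / 2)) =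
  (2 - m * r) * (1 - r / 2) + r ^+ 2 / 2 by field.
by rewrite addr_ge0 ?divr_ge0 ?sqr_ge0 // mulr_ge0 ?subr_ge0 // /r; lra.
Qed.

Lemma abs_iter_cvg (R : realType) (e : R) : 0 < e ->
  exists n, forall t : R, `|t| <= 1 -> `| `|t| - abs_iter n t| < e.
Proof.
move=> e0; set N := Num.bound (2 / e); exists N => t t1.
have [_ pt bound] := abs_iter_bounds N t1.
have : 2 / e < N%:R by apply: archi_boundP; rewrite divr_ge0 // ltW.
rewrite ltr_pdivrMr // ger0_norm ?subr_ge0 // => Ne.
rewrite ltNge; apply/negP => le.
have : N%:R * e <= N.+2%:R * (`|t| - abs_iter N t).
  by apply: ler_pM; rewrite ?ler0n ?ler_nat ?(ltW e0) // ltnW.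
by lra.
Qed.

(** * The Stone-Weierstrass theorem *)

Section StoneWeierstrass.
Context {R : realType} {T : topologicalType}.
Variables (X : set T) (A : set (T -> R)).

Definition uniform_closure : set (T -> R) :=
  [set h | forall e, 0 < e ->
    exists2 a, A a & forall x, X x -> `|h x - a x| < e].

(** Compactness as a local-to-global principle for directed families. It is used
    twice below, with maxima and then with minima, in place of extracting a finite
    subcover. The filter on the indices is the one generated by the upper sets of
    the preorder [P i `<=` P k]. *)
Lemma compact_directed (I : Type) (L : set I) (P : I -> T -> Prop) :
  compact X -> L !=set0 ->
  (forall i j, L i -> L j ->
     exists2 k, L k & forall x, P i x \/ P j x -> P k x) ->
  (forall z, X z -> exists2 i, L i & \forall x \near within X (nbhs z), P i x) ->
  exists2 i, L i & forall x, X x -> P i x.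
Proof.
move=> /compact_near_coveringP/near_covering_withinP cX L0 dir loc.
pose F := filter_from L (fun i => [set k | L k /\ (P i `<=` P k)]).
have FF : Filter F.
  apply: filter_from_filter => // i j Li Lj.
  have [k Lk ijk] := dir i j Li Lj.
  exists k => // l [Ll kl]; split; split=> // x Px; apply: kl; apply: ijk.
    by left.
  by right.
have : \forall i \near F, X `<=` P i.
  apply: cX => z /loc[i Li Pi].
  exists ([set x | X x -> P i x], [set k | L k /\ (P i `<=` P k)]).
    by split=> //=; exists i.
  by move=> [x k] /= [Pix [_ ik]] Xx; apply: ik; exact: Pix.
have : \forall i \near F, L i by case: L0 => i Li; exists i => // k [].
move=> FL FX; have [k Lk kX] : F (L `&` [set k | X `<=` P k]).
  exact: filterI.
have kk : L k /\ P k `<=` P k by split.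
by exists k => //; exact: (kX k kk).2.
Qed.

Lemma near_lt_within (g : T -> R) (c : R) (y : T) :
  {within X, continuous g} -> X y -> g y < c ->
  \forall x \near within X (nbhs y), g x < c.
Proof.
move=> /subspace_continuousP gc Xy gy.
exact: cvgr_lt (gc y Xy) _ gy.
Qed.

Hypothesis X_compact : compact X.
Hypothesis A_cont : forall a, A a -> {within X, continuous a}.
Hypothesis A_cst : forall c, A (fun=> c).
Hypothesis A_add : forall a b, A a -> A b -> A (fun x => a x + b x).
Hypothesis A_mul : forall a b, A a -> A b -> A (fun x => a x * b x).

Lemma algebra_abs_iter n a : A a -> A (fun x => abs_iter n (a x)).
Proof.
move=> Aa; elim: n => [|n IH] /=; first exact: A_cst.
have -> : (fun x => abs_iter n (a x) +
    (a x ^+ 2 - abs_iter n (a x) ^+ 2) / 2) =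
  (fun x => abs_iter n (a x) +
    (a x * a x + (-1) * (abs_iter n (a x) * abs_iter n (a x))) * 2^-1).
  by apply/funext => x; rewrite !expr2 mulN1r.
by do ?[apply: A_add|apply: A_mul|apply: A_cst|assumption].
Qed.

(** Rescaling by a bound [M] of [|a|] on [X] brings the values of [a] into the
    interval where [abs_iter] converges. *)
Lemma closure_abs a : A a -> uniform_closure (fun x => `|a x|).
Proof.
move=> Aa e e0.
have [M M0 aM] : exists2 M : R, 0 < M & forall x, X x -> `|a x| <= M.
  have /ex_strict_bound_gt0[M M0 h] : bounded_set (a @` X).
    by apply/compact_bounded/continuous_compact => //; exact: A_cont.
  by exists M => // x Xx; apply/ltW/h; exists x.
have [n hn] := abs_iter_cvg (divr_gt0 e0 M0).
exists (fun x => M * abs_iter n (M^-1 * a x)).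
  by apply: A_mul => //; apply: algebra_abs_iter; apply: A_mul.
move=> x Xx.
have aM1 : `|M^-1 * a x| <= 1.
  by rewrite normrM gtr0_norm ?invr_gt0 // mulrC ler_pdivrMr // mul1r aM.
have -> : `|a x| = M * `|M^-1 * a x|.
  by rewrite normrM gtr0_norm ?invr_gt0 // mulVKf ?gt_eqF.
by rewrite -mulrBr normrM gtr0_norm // mulrC -ltr_pdivlMr // hn.
Qed.

(** [max h k = (h + k + |h - k|) / 2]: the absolute value turns the algebra into a
    lattice. *)
Lemma closure_max h k : uniform_closure h -> uniform_closure k ->
  uniform_closure (fun x => Num.max (h x) (k x)).
Proof.
move=> ch ck e e0.
have e4 : 0 < e / 4 by lra.
have [a Aa ha] := ch _ e4; have [b Ab kb] := ck _ e4.
have Aab : A (fun x => a x + (-1) * b x).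
  by apply: A_add => //; apply: A_mul.
have [c Ac hc] := closure_abs Aab e4.
exists (fun x => (a x + b x + c x) * 2^-1).
  by do ?[apply: A_add|apply: A_mul|apply: A_cst|assumption].
move=> x Xx; move: (ha x Xx) (kb x Xx) (hc x Xx).
rewrite mulN1r maxr_absE !ltr_norml => /andP[h1 h2] /andP[h3 h4] /andP[h5 h6].
have : `| `|h x - k x| - `|a x - b x| | <= e / 2.
  apply: (le_trans (ler_dist_dist _ _)).
  by rewrite ler_norml; apply/andP; split; lra.
rewrite ler_norml => /andP[h7 h8].
by apply/andP; split; lra.
Qed.

Lemma closure_opp h : uniform_closure h -> uniform_closure (fun x => - h x).
Proof.
move=> ch e e0; have [a Aa ha] := ch e e0.
exists (fun x => -1 * a x); first exact: A_mul.
by move=> x Xx; rewrite mulN1r -opprD normrN ha.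
Qed.

Lemma closure_min h k : uniform_closure h -> uniform_closure k ->
  uniform_closure (fun x => Num.min (h x) (k x)).
Proof.
move=> ch ck.
have -> : (fun x => Num.min (h x) (k x)) =
    (fun x => - Num.max (- h x) (- k x)).
  by apply/funext => x; rewrite oppr_max !opprK.
by apply: closure_opp; apply: closure_max; exact: closure_opp.
Qed.

Lemma subset_closureA : A `<=` uniform_closure.
Proof. by move=> a Aa e e0; exists a => // x _; rewrite subrr normr0. Qed.

Hypothesis A_sep : forall x y, X x -> X y -> x <> y ->
  exists2 a, A a & a x <> a y.

Lemma interpolation (f : T -> R) y z : X y -> X z ->
  exists a, [/\ A a, a y = f y & a z = f z].
Proof.
move=> Xy Xz; have [<-|yz] := pselect (y = z).
  by exists (fun=> f y); split.
have [a Aa /eqP ayz] := A_sep Xy Xz yz.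
exists (fun x => f y + (f z - f y) / (a z - a y) * (a x + - a y)).
split; first by do ?[apply: A_add|apply: A_mul|apply: A_cst|assumption].
- by rewrite subrr mulr0 addr0.
- by rewrite divfK ?subr_eq0 1?eq_sym // addrC subrK.
Qed.

(** For each [y], interpolating [f] at [y] and at every other point, then
    taking maxima, gives a function that is exact at [y] and nowhere much below
    [f]; minima over [y] of such functions are nowhere much above [f] either. *)
Theorem Stone_Weierstrass (f : T -> R) :
  {within X, continuous f} -> uniform_closure f.
Proof.
move=> fc e e0.
have subc (g h : T -> R) : {within X, continuous g} -> {within X, continuous h} ->
    {within X, continuous (fun x => g x - h x)}.
  by move=> gc hc x; apply: cvgB; [exact: gc|exact: hc].
have above y : X y -> exists2 h, uniform_closure h &
    h y = f y /\ forall x, X x -> f x - h x < e / 4.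
  move=> Xy.
  have [|||h [ch hy] hf] := @compact_directed _
    (uniform_closure `&` [set h | h y = f y])
    (fun h x => f x - h x < e / 4) X_compact.
  - by exists (fun=> f y); split => //; apply/subset_closureA.
  - move=> h k [ch hy] [ck ky]; exists (fun x => Num.max (h x) (k x)).
      by split; [exact: closure_max|rewrite /= hy ky maxxx].
    by move=> x; case; apply: le_lt_trans; rewrite lerD2l lerN2 le_max lexx ?orbT.
  - move=> z Xz; have [a [Aa ay az]] := interpolation f Xy Xz.
    exists a; first by split => //; exact: subset_closureA.
    apply: (near_lt_within (subc _ _ fc (A_cont Aa)) Xz).
    by rewrite az subrr; lra.
  - by exists h.
have [|||h [ch hf] hf'] := @compact_directed _
  (uniform_closure `&` [set h | forall x, X x -> f x - h x < e / 2])
  (fun h x => h x - f x < e / 2) X_compact.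
- have [->|/set0P[y /above[h ch [_ hf]]]] := eqVneq X set0.
    by exists (fun=> 0); split => //; apply/subset_closureA.
  by exists h; split => // x Xx; apply: (lt_trans (hf x Xx)); lra.
- move=> h k [ch hf] [ck kf]; exists (fun x => Num.min (h x) (k x)).
    split; first exact: closure_min.
    by move=> x Xx; rewrite minEle; case: ifP => _; [exact: hf|exact: kf].
  by move=> x; case; apply: le_lt_trans; rewrite lerD2r ge_min lexx ?orbT.
- move=> y Xy; have [h ch [hy hf]] := above y Xy.
  have e4 : 0 < e / 4 by lra.
  (* [h] need not be continuous; a nearby member of the algebra is, and it is
     below [f y + e / 4] at [y], hence below [f + e / 2] around [y]. *)
  have [a Aa ha] := ch _ e4.
  exists a.
    split; first exact: subset_closureA.
    by move=> x Xx; move: (hf x Xx) (ha x Xx); rewrite ltr_norml => ? /andP[]; lra.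
  apply: (near_lt_within (subc _ _ (A_cont Aa) fc) Xy).
  by move: (ha y Xy); rewrite hy ltr_norml => /andP[]; lra.
have e2 : 0 < e / 2 by lra.
have [a Aa ha] := ch _ e2; exists a => // x Xx.
move: (hf x Xx) (hf' x Xx) (ha x Xx).
by rewrite !ltr_norml => ? ? /andP[? ?]; apply/andP; split; lra.
Qed.
End StoneWeierstrass.

(** * Sums of cosine ridge functions *)

Section CosineSums.
Context {R : realType} {n : nat}.
Implicit Types (w : 'cV[R]_n) (b : R) (x : 'rV[R]_n).

Definition ridge w b x : R := cos ((x *m w) 0 0 + b).

(** The linear span of the functions [ridge w b x *: v]. The values lie in any
    left module, so that the scalar sums, on which the Stone-Weierstrass theorem
    acts, and the vector-valued ones, which are networks, share their theory. *)
Inductive cos_sum (V : lmodType R) : set ('rV[R]_n -> V) :=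
| CosSum0 : cos_sum (fun=> 0)
| CosSumS w b v h of cos_sum h : cos_sum (fun x => ridge w b x *: v + h x).

Lemma cos_sum_ridge (V : lmodType R) w b (v : V) :
  cos_sum (fun x => ridge w b x *: v).
Proof.
have := CosSumS w b v (CosSum0 V).
by under eq_fun do rewrite addr0.
Qed.

Lemma cos_sumD (V : lmodType R) (h k : 'rV[R]_n -> V) :
  cos_sum h -> cos_sum k -> cos_sum (fun x => h x + k x).
Proof.
move=> + ck; elim=> [|w b v {}h _ IH]; first by under eq_fun do rewrite add0r.
by under eq_fun do rewrite -addrA; exact: CosSumS.
Qed.

Lemma cos_sum_sum (V : lmodType R) m (h : 'I_m -> 'rV[R]_n -> V) :
  (forall i, cos_sum (h i)) -> cos_sum (fun x => \sum_i h i x).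
Proof.
elim: m h => [|m IH] h ch.
  by under eq_fun do rewrite big_ord0; exact: CosSum0.
under eq_fun do rewrite big_ord_recl.
by apply: cos_sumD => //; exact: IH.
Qed.

Lemma cos_sumZl (V : lmodType R) (v : V) (h : 'rV[R]_n -> R^o) :
  cos_sum h -> cos_sum (fun x => h x *: v).
Proof.
elim=> [|w b a {}h _ IH]; first by under eq_fun do rewrite scale0r; left.
by under eq_fun do rewrite scalerDl -scalerA; exact: CosSumS.
Qed.

Lemma cos_sum_cst (V : lmodType R) (v : V) : cos_sum (fun=> v).
Proof.
have -> : (fun=> v) = (fun x => ridge 0 0 x *: v).
  by apply/funext => x; rewrite /ridge mulmx0 mxE addr0 cos0 scale1r.
exact: cos_sum_ridge.
Qed.

Lemma cos_mul (s t : R) : cos s * cos t = (cos (s + t) + cos (s - t)) / 2.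
Proof. by rewrite cosD cosB; field. Qed.

Lemma ridgeM w b w' b' x : ridge w b x * ridge w' b' x =
  (ridge (w + w') (b + b') x + ridge (w - w') (b - b') x) / 2.
Proof.
rewrite /ridge cos_mul mulmxDr mulmxBr !mxE.
by congr ((cos _ + cos _) / 2); ring.
Qed.

(** Products of cosines are sums of cosines; that makes the scalar cosine sums an
    algebra and is the reason for this activation function. *)
Lemma cos_sumM (h k : 'rV[R]_n -> R^o) :
  cos_sum h -> cos_sum k -> cos_sum (fun x => h x * k x : R^o).
Proof.
move=> ch ck; elim: ch => [|w b v {}h _ IH].
  by under eq_fun do rewrite mul0r; left.
under eq_fun do rewrite mulrDl.
apply: cos_sumD => // {h IH}.
elim: ck => [|w' b' v' {}k _ IH]; first by under eq_fun do rewrite mulr0; left.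
under eq_fun do rewrite mulrDr.
apply: cos_sumD => //.
have -> : (fun x => ridge w b x *: v * (ridge w' b' x *: v')) =
  (fun x => ridge (w + w') (b + b') x *: (v * v' / 2 : R^o) +
            ridge (w - w') (b - b') x *: (v * v' / 2 : R^o)).
  apply/funext => x; rewrite /GRing.scale /= -mulrDl mulrACA ridgeM.
  by rewrite -[_ / 2 * _]mulrA [2^-1 * _]mulrC.
by apply: cos_sumD; exact: cos_sum_ridge.
Qed.

(** The frequency is tuned to the two points: the phase is 0 at [x] and a quarter
    turn at [y]. *)
Lemma cos_sum_separates x y : x <> y ->
  exists2 h : 'rV[R]_n -> R^o, cos_sum h & h x <> h y.
Proof.
move=> xy; have [i xyi] : exists i, x 0 i != y 0 i.
  apply/existsP; rewrite -negb_forall; apply/negP => /forallP xy'.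
  by apply: xy; apply/rowP => i; exact/eqP.
pose c := (pi / 2) / (y 0 i - x 0 i).
pose w := c *: delta_mx i (0 : 'I_1).
exists (fun z => ridge w (- c * x 0 i) z *: (1 : R^o)).
  exact: cos_sum_ridge.
have wE z : (z *m w) 0 0 = c * z 0 i.
  by rewrite -scalemxAr mxE -colE mxE.
rewrite /ridge !wE !/(_ *: _) /= !mulr1 mulNr subrr cos0.
rewrite -mulrBr divfK ?subr_eq0 1?eq_sym // cos_pihalf.
by apply/eqP; rewrite oner_eq0.
Qed.

Lemma lform_continuous w : continuous (fun x => (x *m w) 0 0).
Proof.
under eq_fun do rewrite mxE.
apply: continuous_big => [|i _ x].
  exact: add_continuous.
apply: (@continuousM _ _ (fun z : 'rV[R]_n => z 0 i) (cst (w i 0))).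
  exact: coord_continuous.
exact: cst_continuous.
Qed.

Lemma ridge_continuous w b : continuous (ridge w b).
Proof.
rewrite (_ : ridge w b = cos \o (fun z => (z *m w) 0 0 + b)) // => x.
apply: continuous_comp; last first.
  exact: continuous_cos.
apply: (@continuousD _ _ _ _ (cst b)); first exact: lform_continuous.
exact: cst_continuous.
Qed.

Lemma cos_sum_approximates (X : set 'rV[R]_n) (f : 'rV[R]_n -> R) (e : R) :
  compact X -> {within X, continuous f} -> 0 < e ->
  exists2 h : 'rV[R]_n -> R^o, cos_sum h & forall x, X x -> `|f x - h x| < e.
Proof.
move=> cX fc e0.
apply: (@Stone_Weierstrass R 'rV[R]_n X (@cos_sum R^o)) => //.
- move=> h ch; apply: continuous_subspaceT.
  elim: ch => [|w b v {}h _ IH] x; first exact: cst_continuous.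
  apply: (@continuousD _ _ _ (fun z => ridge w b z * v)); last exact: IH.
  apply: (@continuousM _ _ (ridge w b) (cst v)); first exact: ridge_continuous.
  exact: cst_continuous.
- by move=> c; exact: cos_sum_cst.
- by move=> h k; exact: cos_sumD.
- exact: cos_sumM.
- by move=> x y _ _; exact: cos_sum_separates.
Qed.

End CosineSums.

(** * Derivatives of cosine sums, and their realization as networks *)

Section CosineSumsC1.
Context {R : realType} {n d : nat}.
Implicit Types (w : 'cV[R]_n) (b : R) (x : 'rV[R]_n) (v : 'rV[R]_d).

Lemma is_diff_jacobian (h : 'rV[R]_n -> 'rV[R]_d) x J :
  is_diff x h (fun u => u *m J) -> jacobian h x = J.
Proof.
move=> dh; apply/row_matrixP => i.
by rewrite /jacobian !rowE mul_rV_lin1 diff_val.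
Qed.

Lemma is_diff_lform w x :
  is_diff x (fun z => (z *m w) 0 0) (fun z => (z *m w) 0 0).
Proof.
have lin : linear (fun z : 'rV[R]_n => (z *m w) 0 0 : R).
  by move=> a y z; rewrite mulmxDl -scalemxAl !mxE.
pose linM := GRing.isLinear.Build _ _ _ _ _ lin.
pose L : {linear _ -> _} := HB.pack (fun z : 'rV[R]_n => (z *m w) 0 0 : R) linM.
have cL : continuous L by exact: lform_continuous.
have -> : (fun z => (z *m w) 0 0) = L by [].
apply: DiffDef; first exact: linear_differentiable.
exact: diff_lin.
Qed.

Lemma is_diff_ridge w b v x :
  is_diff x (fun z => ridge w b z *: v)
    (fun u => u *m ((- sin ((x *m w) 0 0 + b)) *: (w *m v))).
Proof.
have dphase : is_diff x (fun z => (z *m w) 0 0 + b) (fun u => (u *m w) 0 0).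
  have dl := is_diff_lform w x.
  have := is_diffD dl (is_diff_cst b x).
  by rewrite addr0.
have dcos : is_diff ((x *m w) 0 0 + b) (@cos R)
    ( *:%R^~ (- sin ((x *m w) 0 0 + b))).
  have dc := is_derive_cos ((x *m w) 0 0 + b).
  apply: DiffDef; first exact/derivable1_diffP.
  by rewrite deriv1E // derive1E derive_val.
apply: (is_diff_eq
  (is_diff_comp (is_diff_comp dphase dcos) (is_diff_scalel _ v))).
apply/funext => u /=.
rewrite -scalemxAr mulmxA [u *m w]mx11_scalar mul_scalar_mx scalerA.
by rewrite [_%:M 0 0]mxE eqxx mulr1n mulrC.
Qed.

(** The Jacobian of a cosine sum is itself a sum of matrix-valued ridge terms,
    with the phases shifted by a quarter turn; hence it is continuous. *)
Lemma cos_sum_C1 (h : 'rV[R]_n -> 'rV[R]_d) : cos_sum h ->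
  (forall x, differentiable h x) /\ continuous (jacobian h).
Proof.
suff H : cos_sum h -> exists2 J : 'rV[R]_n -> 'M[R]_(n, d),
    forall x, is_diff x h (fun u => u *m J x) & continuous J.
  move=> /H[J dh cJ]; split; first by move=> x; have [] := dh x.
  suff -> : jacobian h = J by [].
  by apply/funext => x; exact: is_diff_jacobian.
elim=> [|w b v {}h _ [J dh cJ]].
  exists (fun=> 0); last by move=> x; exact: cst_continuous.
  move=> x; apply: is_diff_eq; apply/funext => u.
  by rewrite mulmx0.
exists (fun x => (- sin ((x *m w) 0 0 + b)) *: (w *m v) + J x).
  move=> x; have dr := is_diff_ridge w b v x; have dhx := dh x.
  apply: (is_diff_eq (is_diffD dr dhx)); apply/funext => u.
  by rewrite /= mulmxDr.
move=> x; apply: (@continuousD R 'M[R]_(n, d) 'rV[R]_n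
  (fun z => (- sin ((z *m w) 0 0 + b)) *: (w *m v))); last exact: cJ.
have -> : (fun z => (- sin ((z *m w) 0 0 + b)) *: (w *m v)) =
    (fun z => ridge w (b + pi / 2) z *: (w *m v)).
  by apply/funext => z; rewrite /ridge addrA cosDpihalf.
apply: (@continuous_comp _ _ _ (ridge w (b + pi / 2)) ( *:%R^~ (w *m v))).
  exact: ridge_continuous.
exact: scalel_continuous.
Qed.

(** One hidden unit per term: the frequencies are the columns of the first weight
    matrix and the coefficients the rows of the second. The empty sum uses one
    unit of output weight zero, since a layer has at least one unit. *)
Lemma cos_sum_network (h : 'rV[R]_n -> 'rV[R]_d) : cos_sum h ->
  exists m (W : 'M[R]_(n, m.+1)) (b : 'rV[R]_m.+1) (V : 'M[R]_(m.+1, d)),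
    h = net_eval (Hidden W b cos (Output V 0)).
Proof.
elim=> [|w b v {}h _ [m [W [c [V ->]]]]].
  by exists 0%N, 0, 0, 0; apply/funext => x /=; rewrite mulmx0 addr0.
exists m.+1, (row_mx w W : 'M[R]_(n, 1 + m.+1)),
  (row_mx (b%:M) c : 'M[R]_(1, 1 + m.+1)), (col_mx v V : 'M[R]_(1 + m.+1, d)).
apply/funext => x /=; rewrite !addr0.
(* Stated at width [1 + m.+1], which is convertible to [m.+2], so that the
   lemmas on block matrices apply. *)
have split_layer : map_mx cos (x *m row_mx w W + row_mx (b%:M) c) *m col_mx v V
    = ridge w b x *: v + map_mx cos (x *m W + c) *m V.
  rewrite mul_mx_row add_row_mx map_row_mx mul_row_col; congr (_ + _).
  rewrite [map_mx _ _]mx11_scalar mul_scalar_mx /ridge.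
  by congr (_ *: _); rewrite !mxE eqxx mulr1n.
by rewrite -split_layer.
Qed.

End CosineSumsC1.

Lemma bounded_cos (R : realType) : bounded_fun (@cos R).
Proof.
exists 1; split=> // M M1 t _; exact/(le_trans (cos_max t))/ltW.
Qed.

Lemma cos_nonconstant (R : realType) : ~ exists c : R, forall t, cos t = c.
Proof.
by move=> [c cE]; move: (cE 0) (cE pi); rewrite cos0 cospi => <-; lra.
Qed.

Lemma cos_C1 (R : realType) : C1_scalar (@cos R).
Proof.
have d1 : derive1 (@cos R) = (fun t => - sin t).
  by apply/funext => t; rewrite derive1E derive_val.
split=> [t|]; first exact: derivable_cos.
by rewrite d1 => t; apply: continuousN; exact: continuous_sin.
Qed.

(** * The l1 norm *)

Section L1Norm.
Context {R : realType} {d : nat}.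
Implicit Types u v : 'rV[R]_d.

Lemma l1norm0 : l1norm (0 : 'rV[R]_d) = 0.
Proof. by apply: big1 => i _; rewrite mxE normr0. Qed.

Lemma l1normN v : l1norm (- v) = l1norm v.
Proof. by apply: eq_bigr => i _; rewrite mxE normrN. Qed.

Lemma l1normZ a v : l1norm (a *: v) = `|a| * l1norm v.
Proof. by rewrite mulr_sumr; apply: eq_bigr => i _; rewrite mxE normrM. Qed.

Lemma l1norm_triangle u v : l1norm (u + v) <= l1norm u + l1norm v.
Proof. by rewrite -big_split; apply: ler_sum => i _; rewrite mxE ler_normD. Qed.

Lemma l1norm_ge0 v : 0 <= l1norm v.
Proof. exact: sumr_ge0. Qed.

End L1Norm.

(** * Approximation with vanishing Jacobian at the origin *)

Section FlatApproximation.
Context {R : realType} {n d : nat}.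

(** Isolated as a predicate of [J] because it is additive in [J], which reduces
    it to matrices of rank one. *)
Definition small_with_jacobian (J : 'M[R]_(n, d)) : Prop :=
  forall e, 0 < e -> exists k : 'rV[R]_n -> 'rV[R]_d,
    [/\ cos_sum k, is_diff 0 k (fun u => u *m J)
      & forall x, l1norm (k x) < e].

(** The witness is [sin (K (x . w)) *: (v / K)], the sine being a cosine of
    phase [- pi / 2]: the factors [K] cancel in the derivative at 0. *)
Lemma small_with_jacobian_rank1 (w : 'cV[R]_n) (v : 'rV[R]_d) :
  small_with_jacobian (w *m v).
Proof.
move=> e e0; set K := l1norm v / e + 1.
(* [l1norm v / K < e], with [K] positive even when [v = 0]. *)
have v0 := l1norm_ge0 v.
have K0 : 0 < K by rewrite ltr_pwDr // divr_ge0 // ltW.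
exists (fun x => ridge (K *: w) (- (pi / 2)) x *: (K^-1 *: v)); split.
- exact: cos_sum_ridge.
- apply: (is_diff_eq (is_diff_ridge _ _ _ _)); apply/funext => u.
  rewrite mul0mx mxE add0r sinN sin_pihalf opprK scale1r.
  by rewrite -scalemxAl -!scalemxAr scalerA mulfV ?gt_eqF // scale1r.
- move=> x; rewrite !l1normZ.
  apply: (@le_lt_trans _ _ (1 * (`|K^-1| * l1norm v))).
    by rewrite ler_wpM2r ?cos_max // mulr_ge0.
  rewrite mul1r gtr0_norm ?invr_gt0 // mulrC ltr_pdivrMr //.
  by rewrite /K mulrDr mulrCA mulfV ?gt_eqF // mulr1 ltrDl mulr1.
Qed.

(** Uniform smallness puts no constraint on the derivative at a point. The matrix
    is cut into its rows, each of which contributes a matrix of rank one. *)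
Lemma cos_sum_small_with_jacobian (J : 'M[R]_(n, d)) : small_with_jacobian J.
Proof.
have -> : J = \sum_i delta_mx i (0 : 'I_1) *m row i J.
  apply/matrixP => a b; rewrite summxE (bigD1 a) //= big1 => [|i ia].
    by rewrite addr0 mxE big_ord1 !mxE !eqxx mul1r.
  by rewrite mxE big_ord1 !mxE eq_sym (negbTE ia) mul0r.
elim/big_ind: _ => [|J1 J2 sJ1 sJ2|i _].
- move=> e e0; exists (fun=> 0); split; first exact: CosSum0.
    by apply: is_diff_eq; apply/funext => u; rewrite mulmx0.
  by move=> x; rewrite l1norm0.
- move=> e e0; have e2 : 0 < e / 2 by lra.
  have [k1 [ck1 dk1 k1e]] := sJ1 _ e2; have [k2 [ck2 dk2 k2e]] := sJ2 _ e2.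
  exists (fun x => k1 x + k2 x); split; first exact: cos_sumD.
    apply: (is_diff_eq (is_diffD dk1 dk2)); apply/funext => u.
    by rewrite mulmxDr.
  move=> x; apply: (le_lt_trans (l1norm_triangle _ _)).
  by move: (k1e x) (k2e x); lra.
- exact: small_with_jacobian_rank1.
Qed.

Lemma cos_sum_vector_approximates (X : set 'rV[R]_n)
    (g : 'rV[R]_n -> 'rV[R]_d) (e : R) :
  compact X -> {within X, continuous g} -> 0 < e ->
  exists2 h : 'rV[R]_n -> 'rV[R]_d, cos_sum h &
    forall x, X x -> l1norm (g x - h x) < e.
Proof.
move=> cX gc e0.
(* [d.+1] rather than [d]: the bound is positive also when [d = 0], and the
   sum of the [d] errors stays strictly below [e]. *)
have e1 : 0 < e / d.+1%:R by rewrite divr_gt0.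
have coord j : {h : 'rV[R]_n -> R^o | cos_sum h /\
    forall x, X x -> `|g x 0 j - h x| < e / d.+1%:R}.
  apply: cid.
  have [|h ch hg] := @cos_sum_approximates _ _ X (fun x => g x 0 j) _ cX _ e1.
    move=> x; apply: (@continuous_comp (subspace X) _ _ g
      (fun v : 'rV[R]_d => v 0 j)).
      exact: gc.
    exact: coord_continuous.
  by exists h.
pose h j := sval (coord j).
exists (fun x => \sum_j h j x *: delta_mx 0 j).
  by apply: cos_sum_sum => j; apply: cos_sumZl; exact: (svalP (coord j)).1.
move=> x Xx; apply: (@le_lt_trans _ _ (\sum_(j < d) e / d.+1%:R)).
  apply: ler_sum => j _; rewrite !mxE summxE (bigD1 j) //= big1 => [|i ij].
    rewrite addr0 !mxE !eqxx mulr1; apply/ltW.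
    exact: (svalP (coord j)).2.
  by rewrite !mxE eqxx eq_sym (negbTE ij) mulr0.
rewrite sumr_const card_ord -[_ *+ d]mulr_natr -mulrA gtr_pMr //.
by rewrite mulrC ltr_pdivrMr // mul1r ltr_nat.
Qed.

(** A small cosine sum whose Jacobian at 0 is the opposite of that of the
    approximant cancels it and costs only a small uniform error. *)
Lemma cos_sum_flat_approximates (X : set 'rV[R]_n)
    (g : 'rV[R]_n -> 'rV[R]_d) (e : R) :
  compact X -> {within X, continuous g} -> 0 < e ->
  exists h : 'rV[R]_n -> 'rV[R]_d, [/\ cos_sum h, jacobian h 0 = 0 &
    forall x, X x -> l1norm (g x - h x) < e].
Proof.
move=> cX gc e0; have e2 : 0 < e / 2 by lra.
have [h ch gh] := cos_sum_vector_approximates cX gc e2.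
have [k [ck dk ke]] := cos_sum_small_with_jacobian (- jacobian h 0) e2.
exists (fun x => h x + k x); split; first exact: cos_sumD.
  apply: is_diff_jacobian.
  have /differentiableP dh := (cos_sum_C1 ch).1 0.
  apply: (is_diff_eq (is_diffD dh dk)); apply/funext => u.
  by rewrite fctE mulmxN mul_rV_lin1 subrr mulmx0.
move=> x Xx; rewrite opprD addrA; apply: (le_lt_trans (l1norm_triangle _ _)).
by rewrite l1normN; move: (gh x Xx) (ke x); lra.
Qed.

End FlatApproximation.

(** * Approximation by networks *)

Theorem theorem1 (R : realType) (n d : nat) (X : set 'rV[R]_n)
    (f : 'rV[R]_n -> 'rV[R]_d)
    (X_compact : compact X) (X_int0 : interior X 0)
    (f_cont : {within X, continuous f}) (f0 : f 0 = 0)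
    (f_C1 : C1_near [set 0] f) (eps : R) (eps_gt0 : 0 < eps) :
  exists N : network R d n,
    [/\ (0 < hidden_layers N)%N,
        forall s : R -> R, activations N s ->
          [/\ bounded_fun s, ~ (exists c : R, forall t : R, s t = c)
            & C1_scalar s],
        C1_near X (net_eval N)
      & forall x : 'rV[R]_n, X x ->
          l1norm (f x - (x *m (jacobian f 0 - jacobian (net_eval N) 0)
                         + net_eval N x - net_eval N 0)) < eps].
Proof.
pose g x := f x - x *m jacobian f 0.
have gc : {within X, continuous g}.
  have lc : continuous (fun x : 'rV[R]_n => x *m jacobian f 0).
    have -> : (fun x : 'rV[R]_n => x *m jacobian f 0) =
        (fun x => \sum_i x 0 i *: row i (jacobian f 0)).
      by apply/funext => x; exact: mulmx_sum_row.
    apply: continuous_big => [|i _ x]; first exact: add_continuous.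
    apply: (@continuous_comp _ _ _ (fun x : 'rV[R]_n => x 0 i)
      ( *:%R^~ (row i (jacobian f 0)))); first exact: coord_continuous.
    exact: scalel_continuous.
  move=> x; apply: cvgB; first exact: f_cont.
  exact: continuous_subspaceT.
have eps2 : 0 < eps / 2 by lra.
have [h [ch h0 gh]] := cos_sum_flat_approximates X_compact gc eps2.
have [hC1 hcont] := cos_sum_C1 ch.
have [m [W [b [V hE]]]] := cos_sum_network ch.
exists (Hidden W b cos (Output V 0)); rewrite -hE; split.
- by [].
- move=> s [-> | []].
  by split; [exact: bounded_cos|exact: cos_nonconstant|exact: cos_C1].
- exists setT; split=> //; first exact: openT.
  exact: continuous_subspaceT.
- move=> x Xx; rewrite h0 subr0.
  have -> : f x - (x *m jacobian f 0 + h x - h 0) = (g x - h x) - (g 0 - h 0).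
    by rewrite /g f0 mul0mx subr0 sub0r opprK !opprD opprK !addrA.
  apply: (le_lt_trans (l1norm_triangle _ _)); rewrite l1normN.
  by move: (gh x Xx) (gh 0 (interior_subset X_int0)); lra.
Qed.
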